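(* Let $\mathcal{T}^d=(\mathcal{N},\mathcal{E},d)$ be a tree diagram and let $L_1(\mathcal{T}^d)$ be the associated upward solvable Lie algebra of differential operators. Any nonzero abelian ideal of $L_1(\mathcal{T}^d)$ is of the form $I[S,\{K_r\mid\iota_r\in W\}]$ for some admissible pair $(S,\{K_r\mid\iota_r\in W\})$. Consequently, the map $(S,\{K_r\mid\iota_r\in W\})\mapsto I[S,\{K_r\mid\iota_r\in W\}]$ is a one-to-one correspondence between the set of admissible pairs and the set of nonzero abelian ideals of $L_1(\mathcal{T}^d)$.
   Context: A tree $\mathcal{T}=(\mathcal{N},\mathcal{E})$ consists of a finite set of nodes $\mathcal{N}=\{\iota_1,\ldots,\iota_n\}$ and a set of edges $\mathcal{E}\subset\{(\iota_i,\iota_j)\mid 1\le i<j\le n\}$ such that for each node $\iota_i$ there is a unique sequence $\mathcal{C}_i=\{\iota_{i_1},\ldots,\iota_{i_r}\}$ of nodes with $1=i_1<i_2<\cdots<i_r=i$ and $(\iota_{i_s},\iota_{i_{s+1}})\in\mathcal{E}$ for $1\le s\le r-1$; $\mathcal{C}_i$ is called the clan of $\iota_i$ (so $\mathcal{C}_1=\{\iota_1\}$). A tree diagram $\mathcal{T}^d=(\mathcal{N},\mathcal{E},d)$ is a tree with a map $d:\mathcal{E}\to\{1,2,3,\ldots\}$. Let $\mathbb{A}$ be the associative algebra of differential operators in $x_1,\ldots,x_n$ with coefficients in $\mathbb{C}[x_1,\ldots,x_n]$, with Lie bracket $[A,B]=AB-BA$; write $\partial_{x_i}=\partial/\partial x_i$.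 Let $L_0(\mathcal{T}^d)$ be the Lie subalgebra of $\mathbb{A}$ generated by $\partial_{x_1}$ and all $x_i^{d[(\iota_i,\iota_j)]}\partial_{x_j}$ with $(\iota_i,\iota_j)\in\mathcal{E}$. Let $H=\sum_{i=1}^n\mathbb{C}x_i\partial_{x_i}$ and $L_1(\mathcal{T}^d)=H+L_0(\mathcal{T}^d)$. For $2\le i\le n$ with $\mathcal{C}_i=\{\iota_{i_1},\ldots,\iota_{i_r}\}$, let $$R_i=\Big\{(j_1,\ldots,j_{r-1})\in\mathbb{N}^{r-1}\ \Big|\ j_1+\sum_{s=2}^{r-1}j_s\,d[(\iota_{i_1},\iota_{i_2})]\cdots d[(\iota_{i_{s-1}},\iota_{i_s})]\le d[(\iota_{i_1},\iota_{i_2})]\cdots d[(\iota_{i_{r-1}},\iota_{i_r})]\Big\},$$ where $\mathbb{N}=\{0,1,2,\ldots\}$, and for $\vec j=(j_1,\ldots,j_{r-1})\in R_i$ put $x^{\vec j}=x_{i_1}^{j_1}\cdots x_{i_{r-1}}^{j_{r-1}}$. Also $R_1=\{0\}$ and $x^0=1$. Define a (reflexive) partial order $\prec$ on $R_i$ by $(j_1,\ldots,j_{r-1})\prec(l_1,\ldots,l_{r-1})$ if for every $1\le s\le r-1$ $$j_s+\sum_{\epsilon=s+1}^{r-1}j_\epsilon\, d[(\iota_{i_s},\iota_{i_{s+1}})]\cdots d[(\iota_{i_{\epsilon-1}},\iota_{i_\epsilon})]\le l_s+\sum_{\epsilon=s+1}^{r-1}l_\epsilon\, d[(\iota_{i_s},\iota_{i_{s+1}})]\cdots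 d[(\iota_{i_{\epsilon-1}},\iota_{i_\epsilon})].$$ A node $\iota_i$ is multiplicity-free if there is $j<i$ with $(\iota_j,\iota_i)\in\mathcal{E}$ and $d[(\iota_j,\iota_i)]=1$. A node $\iota_j$ is a descendant of $\iota_i$ if $i<j$ and $\iota_i\in\mathcal{C}_j$; $\mathcal{D}_i$ is the set of all descendants of $\iota_i$. Put $\Upsilon=\{\iota_i\in\mathcal{N}\mid \iota_j\text{ is multiplicity-free for every }\iota_j\in\mathcal{D}_i\}$. A set $S$ of nodes is independent if no element of $S$ is a descendant of another element of $S$. A subset $K$ of $R_i$ is independent if every element of $K$ is maximal in $K$ with respect to $\prec$ (the empty set is allowed). If $\iota_s\in\mathcal{D}_i$, regard $R_i$ as a subset of $R_s$ by extending vectors by zeros (so that $x^{\vec j}$ is unchanged); this inclusion is compatible with $\prec$. For a node $\iota_s$ and $\vec j\in R_s$ put $$I[s,\vec j]=\mathrm{Span}\{x^{\vec l}\partial_{x_s},\ x^{\vec l}\partial_{x_r}\mid \iota_r\in\mathcal{D}_s,\ \vec l\in R_s,\ \vec l\prec\vec j\}.$$ Admissible pairs: choose a nonempty independent set $S\subset\Upsilon$ and put $W=S\cup\bigcup_{\iota_i\in S}\mathcal{D}_i$. For each $\iota_i\in S$ and each $\iota_\epsilon\in\mathcal{D}_i$ choose independent subsets $K_i,K_\epsilon\subset R_i$ such that $K_i\ne\emptyset$ and such that, for all $\iota_r\in W$ and $\iota_s\in\mathcal{D}_r$, one has $\vec l\not\prec\vec j$ for all $\vec j\in K_r$ and $\vec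 l\in K_s$. Then $(S,\{K_r\mid\iota_r\in W\})$ is called an admissible pair, and $$I[S,\{K_r\mid\iota_r\in W\}]=\sum_{\iota_s\in W}\ \sum_{\vec j\in K_s}I[s,\vec j].$$ *)

(* Defs.v *)
From HB Require Import structures.
From mathcomp Require Import all_boot all_order all_algebra.
From mathcomp Require Import boolp classical_sets functions reals.
From mathcomp Require Import complex.
From mathcomp Require Import mpoly.

Set Implicit Arguments.
Unset Strict Implicit.
Unset Printing Implicit Defensive.

Import GRing.Theory.

Local Open Scope classical_set_scope.
Local Open Scope ring_scope.

(* The nodes iota_1, ..., iota_(n+1) are the elements 0, ..., n of 'I_n.+1.   *)
(* The values of [edge_mult], the map d, outside the edge relation are        *)
(* irrelevant: it is only ever evaluated on edges.                            *)
Record tree_diagram (n : nat) := TreeDiagram {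
  edge : rel 'I_n.+1;
  edge_lt : forall i j, edge i j -> (i < j)%N;
  edge_path : forall i, exists! p : seq 'I_n.+1,
    path edge ord0 p && (last ord0 p == i);
  edge_mult : 'I_n.+1 -> 'I_n.+1 -> nat;
  edge_mult_gt0 : forall i j, edge i j -> (0 < edge_mult i j)%N
}.

Section Tree.
Variables (n : nat) (T : tree_diagram n).
Implicit Types (i : 'I_n.+1).

Lemma edge_path_ex i :
  exists p : seq 'I_n.+1, path (edge T) ord0 p && (last ord0 p == i).
Proof. by have [p [Hp _]] := edge_path T i; exists p. Qed.

Definition clan i : seq 'I_n.+1 := ord0 :: xchoose (edge_path_ex i).

Definition descendants i : set 'I_n.+1 :=
  [set j : 'I_n.+1 | (i < j)%N /\ i \in clan j].

Definition multiplicity_free i : Prop :=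
  exists j : 'I_n.+1, [/\ (j < i)%N, edge T j i & edge_mult T j i = 1%N].

Definition Upsilon : set 'I_n.+1 :=
  [set i : 'I_n.+1 | forall j : 'I_n.+1, descendants i j -> multiplicity_free j].

Definition independent_nodes (S : set 'I_n.+1) : Prop :=
  forall i j : 'I_n.+1, S i -> S j -> ~ descendants i j.

(* With clan i = [:: i_0; ...; i_(r-1)], [clan_prod i a b] is                 *)
(*   d[(i_a, i_(a+1))] ... d[(i_(b-1), i_b)],                                 *)
(* an empty product when a = b.                                               *)
Definition clan_prod i (a b : nat) : nat :=
  \prod_(a <= k < b) edge_mult T (nth ord0 (clan i) k) (nth ord0 (clan i) k.+1).

(* An exponent vector over the proper ancestors of iota_i is encoded as a     *)
(* monomial in all n+1 variables, zero outside clan i \ {i}, so that the      *)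
(* extension by zeros embedding R_i in R_s (iota_s a descendant of iota_i) is *)
(* the identity.  [weight i l a] is the sum attached to position a of the     *)
(* clan, the term at e = a having the empty product as its coefficient.       *)
Definition weight i (l : 'X_{1..n.+1}) (a : nat) : nat :=
  \sum_(a <= e < (size (clan i)).-1) l (nth ord0 (clan i) e) * clan_prod i a e.

(* For i = 0 the sum is empty and the support condition leaves only 0.        *)
Definition Rset i : set 'X_{1..n.+1} :=
  [set l : 'X_{1..n.+1} | (forall k : 'I_n.+1, l k != 0%N -> k \in clan i /\ k != i) /\
           (weight i l 0 <= clan_prod i 0 (size (clan i)).-1)%N].

Definition prec i (j l : 'X_{1..n.+1}) : Prop :=
  forall a, (a < (size (clan i)).-1)%N -> (weight i j a <= weight i l a)%N.

Definition independent_exponents i (K : set 'X_{1..n.+1}) : Prop :=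
  K `<=` Rset i /\ forall j l : 'X_{1..n.+1}, K j -> K l -> prec i j l -> l = j.

Definition Wset (S : set 'I_n.+1) : set 'I_n.+1 :=
  S `|` \bigcup_(i in S) descendants i.

(* The family {K_r | r in W} is encoded as a total function that is empty     *)
(* outside W, so that equal families are equal functions.                     *)
Definition admissible_pair
    (S : set 'I_n.+1) (K : 'I_n.+1 -> set 'X_{1..n.+1}) : Prop :=
  [/\ [/\ S !=set0, independent_nodes S & S `<=` Upsilon],
      forall i : 'I_n.+1, S i -> independent_exponents i (K i) /\ K i !=set0,
      forall i e : 'I_n.+1, S i -> descendants i e -> independent_exponents i (K e),
      forall r s : 'I_n.+1, Wset S r -> descendants r s ->
        forall j l : 'X_{1..n.+1}, K r j -> K s l -> ~ prec s l j &
      forall r : 'I_n.+1, ~ Wset S r -> K r = set0].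

End Tree.

Section LinearSpan.
Variables (F : fieldType) (V : lmodType F).

Definition subspace (U : set V) : Prop := submod_closed (mem U).

Definition lspan (X : set V) : set V :=
  [set v | forall U, subspace U -> X `<=` U -> U v].

End LinearSpan.

(* Linearity is not required of [mpoly_op]: the operators considered all lie  *)
(* in [diffop], generated by multiplications and partial derivatives.         *)
Notation mpoly_op F n := ({mpoly F[n]} -> {mpoly F[n]}).

Section DiffOp.
Variables (F : fieldType) (n : nat).

Local Notation op := (mpoly_op F n).

Implicit Types (A B : op) (L I : set op).

Inductive diffop : set op :=
| diffop_mul (p : {mpoly F[n]}) : diffop (fun f => p * f)
| diffop_deriv (i : 'I_n) : diffop (mderiv i)
| diffop_add A B : diffop A -> diffop B -> diffop (A + B)
| diffop_comp A B : diffop A -> diffop B -> diffop (A \o B).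

Definition bracket A B : op := (A \o B) - (B \o A).

Definition lie_subalgebra L : Prop :=
  [/\ L `<=` diffop, subspace L &
      forall A B, L A -> L B -> L (bracket A B)].

Definition lie_generated (X : set op) : set op :=
  [set A | forall L, lie_subalgebra L -> X `<=` L -> L A].

Definition lie_ideal L I : Prop :=
  [/\ I `<=` L, subspace I & forall A B, L A -> I B -> I (bracket A B)].

Definition abelian I : Prop := forall A B, I A -> I B -> bracket A B = 0.

Definition nonzero_abelian_ideal L I : Prop :=
  [/\ lie_ideal L I, abelian I & exists2 A, I A & A <> 0].

(* The operator x^l d/dx_s. *)
Definition monomial_deriv (l : 'X_{1..n}) (s : 'I_n) : op :=
  fun f => 'X_[l] * mderiv s f.

End DiffOp.

Section TreeLie.
Variables (F : fieldType) (n : nat) (T : tree_diagram n).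

Local Notation opT := (mpoly_op F n.+1).

Definition L0_generators : set opT :=
  [set A | A = mderiv ord0 \/
     exists i j, edge T i j /\ A = monomial_deriv (U_(i) *+ edge_mult T i j)%MM j].

Definition L0 : set opT := lie_generated L0_generators.

Definition Hspace : set opT :=
  lspan [set monomial_deriv U_(i)%MM i | i in [set: 'I_n.+1]].

Definition L1 : set opT := [set A + B | A in Hspace & B in L0].

Definition I_node (s : 'I_n.+1) (j : 'X_{1..n.+1}) : set opT :=
  lspan [set A | exists r l, [/\ r = s \/ descendants T s r,
     Rset T s l, prec T s l j & A = monomial_deriv l r]].

(* A sum of subspaces is the span of their union. *)
Definition I_pair (S : set 'I_n.+1) (K : 'I_n.+1 -> set 'X_{1..n.+1}) :
    set opT :=
  lspan (\bigcup_(s in Wset T S) \bigcup_(j in K s) I_node s j).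

End TreeLie.

Arguments L0 F {n} T.
Arguments L1 F {n} T.
Arguments I_node F {n} T s j.
Arguments I_pair F {n} T S K.

(* Main.v *)
Require Import Defs.
From mathcomp Require Import all_boot all_order all_algebra.
From mathcomp Require Import boolp classical_sets functions reals.
From mathcomp Require Import complex.
From mathcomp Require Import mpoly.
From mathcomp Require Import zify.

Set Implicit Arguments.
Unset Strict Implicit.
Unset Printing Implicit Defensive.

Import GRing.Theory Num.Theory.

Local Open Scope classical_set_scope.
Local Open Scope ring_scope.

(** The whole question is about monomial operators x^l d_s (with d_s the
    derivative in x_s) and how the bracket moves their exponents.

    Reduction to monomials.  L_0 has the basis x^l d_s with l in R_s
    ([L0_monomial], [L0_span]).  The Euler operator x_k d_k multiplies x^l d_s
    by l_k - [k = s]; since l_s = 0 for l in R_s, these weights separate the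
    basis elements from each other and from H, whose weight is zero.  An ideal
    is therefore the sum of its part in H and of the lines of basis elements
    that it contains, and commutativity kills the part in H
    ([ideal_Hspace], [ideal_sub_span]).  So an abelian ideal I is the same
    thing as the family of exponent sets E_s = { l in R_s | x^l d_s in I }.

    The moves.  In the formula

      [x^j d_k, x^l d_s] = l_k x^(j + l - e_k) d_s - j_s x^(l + j - e_s) d_k

    at most one term survives, because j only involves proper ancestors of k
    and l proper ancestors of s.
    - If k is an ancestor of s, a factor x_k of x^l is traded for x^j with j
      in R_k.  The order on R_s compares the weights w_a of exponents, which
      obey w_a = l_a + d_a w_(a+1); taking for j the generator x_p^d d_k at
      the edge (p, k) lowers exactly one weight by one, and any smaller
      exponent can be reached in this way ([descent]).  Hence the E_s are
      closed downwards.
    - If k is a descendant of s, the choice j = e_s gives E_s included in E_k,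
      while j = 2 e_s, which is possible as soon as the path from s to k is
      not multiplicity free, gives two elements of I that do not commute.
      Hence E_s nonempty forces s to lie in Upsilon ([ideal_Upsilon]), and for
      such s the set R_k contains no vector involving x_s other than e_s
      ([Upsilon_Rset]).

    The correspondence.  A family E with these closure properties is recovered
    from its bottom nodes S, those without a proper ancestor p with E_p
    nonempty, and from the sets K_s of maximal elements of E_s which belong to
    no E_p with p a proper ancestor of s.  For an abelian ideal this pair is
    admissible and spans I ([ideal_admissible], [ideal_pair]); conversely an
    admissible pair spans an abelian ideal ([admissible_ideal]) and is the
    pair of bottom nodes and new maximal elements of its family of exponents
    ([admissible_bottom_nodes], [new_maximal_pair]), whence injectivity. *)

(** * Clans, weights and the order on exponents *)

Section Combinatorics.
Local Open Scope nat_scope.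
Variables (n : nat) (T : tree_diagram n).
Implicit Types (i k m p s : 'I_n.+1) (l j : 'X_{1..n.+1}) (a b : nat).

Local Notation depth i := (size (clan T i)).-1.
Local Notation anc i a := (nth ord0 (clan T i) a).

Lemma clanP i : exists2 q, clan T i = ord0 :: q &
  path (edge T) ord0 q /\ last ord0 q = i.
Proof.
exists (xchoose (edge_path_ex T i)) => //.
by have /andP[-> /eqP ->] := xchooseP (edge_path_ex T i).
Qed.

(* Simplification must not expose the choice of the path behind a clan. *)
Local Opaque clan.

Lemma clan_last q : path (edge T) ord0 q -> clan T (last ord0 q) = ord0 :: q.
Proof.
move=> pq; have [q' -> [pq' lq']] := clanP (last ord0 q); congr cons.
have [r [_ ru]] := edge_path T (last ord0 q).
by rewrite -(ru q) ?pq ?eqxx // -(ru q') // pq' lq' eqxx.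
Qed.

Lemma clan_edge p i : edge T p i -> clan T i = rcons (clan T p) i.
Proof.
move=> e; have [q -> [pq lq]] := clanP p.
by rewrite -{1}(last_rcons ord0 q i) clan_last // rcons_path pq lq.
Qed.

(** Clans are nested: ancestors carry the same initial segment, so that
    positions in the clan of a node make sense for all its descendants. *)
Lemma clan_prefix k i : k \in clan T i -> exists q, clan T i = clan T k ++ q.
Proof.
have [q -> [pq _]] := clanP i => kq; case/splitPl: kq pq => q1 q2 <- pq.
by exists q2; rewrite clan_last //; move: pq; rewrite cat_path => /andP[].
Qed.

Lemma size_clan i : size (clan T i) = (depth i).+1.
Proof. by have [q -> _] := clanP i. Qed.

Lemma ltn_clan i a : (a < size (clan T i)) = (a <= depth i).
Proof. by rewrite size_clan ltnS. Qed.

Lemma clan_self i : i \in clan T i.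
Proof. by have [q -> [_ lq]] := clanP i; rewrite -{1}lq; exact: mem_last. Qed.

Lemma anc_depth i : anc i (depth i) = i.
Proof. by have [q -> [_ lq]] := clanP i; rewrite nth_last. Qed.

Lemma clan_sorted i : sorted (fun k m => k < m) (clan T i).
Proof.
have [q -> [pq _]] := clanP i; apply: sub_path pq => k m; exact: edge_lt.
Qed.

Lemma clan_uniq i : uniq (clan T i).
Proof.
apply: (sorted_uniq _ _ (clan_sorted i)) => [x y z|x]; [exact: ltn_trans|exact: ltnn].
Qed.

Lemma clan_trans i k m : k \in clan T i -> m \in clan T k -> m \in clan T i.
Proof. by case/clan_prefix => q ->; rewrite mem_cat => ->. Qed.

Lemma anc_prefix i k a : k \in clan T i -> a <= depth k -> anc i a = anc k a.
Proof. by case/clan_prefix => q -> ak; rewrite nth_cat ltn_clan ak. Qed.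

Lemma depth_le i k : k \in clan T i -> depth k <= depth i.
Proof. by case/clan_prefix => q ->; rewrite size_cat size_clan; lia. Qed.

Lemma depth_lt i k : k \in clan T i -> k != i -> depth k < depth i.
Proof.
move=> ki; apply: contraNltn => dk; apply/eqP.
rewrite -(anc_depth k) -(anc_depth i) -(anc_prefix ki) //.
by congr (nth _ _ _); apply/eqP; rewrite eqn_leq depth_le.
Qed.

Lemma clan_anti i k : k \in clan T i -> i \in clan T k -> k = i.
Proof.
move=> ki ik; apply/eqP; apply/negP => /negP ne.
by have := depth_lt ki ne; have := depth_le ik; lia.
Qed.

Lemma anc_mem i a : a <= depth i -> anc i a \in clan T i.
Proof. by move=> ai; rewrite mem_nth // ltn_clan. Qed.

Lemma depth_anc i a : a <= depth i -> depth (anc i a) = a.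
Proof.
move=> ai; have ki := anc_mem ai; have di := depth_le ki.
have /eqP := anc_prefix ki (leqnn _); rewrite anc_depth.
by rewrite nth_uniq ?clan_uniq ?ltn_clan // => /eqP.
Qed.

Lemma anc_neq i a : a < depth i -> anc i a != i.
Proof. by move=> ai; apply/eqP => e; have := depth_anc (ltnW ai); rewrite e; lia. Qed.

Lemma edge_anc i a : a < depth i -> edge T (anc i a) (anc i a.+1).
Proof.
have [q -> [pq _]] /= := clanP i => aq.
by move/(pathP ord0): pq; apply.
Qed.

Lemma clan_parent p i k : edge T p i -> k \in clan T i -> k != i -> k \in clan T p.
Proof.
by move=> pi; rewrite (clan_edge pi) mem_rcons inE => /predU1P[->|//]; rewrite eqxx.
Qed.

Lemma edge_unique p q i : edge T p i -> edge T q i -> p = q.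
Proof.
move=> pi qi; have e : clan T p = clan T q.
  by apply: (@rcons_injl _ i); rewrite -!clan_edge.
by rewrite -[p]anc_depth e anc_depth.
Qed.

Lemma clan_total i k m :
  k \in clan T i -> m \in clan T i -> k \in clan T m \/ m \in clan T k.
Proof.
suff W k' m' : k' \in clan T i -> m' \in clan T i -> depth k' <= depth m' ->
    k' \in clan T m'.
  by move=> ki mi; case/orP: (leq_total (depth k) (depth m)); [left|right]; apply: W.
move=> ki mi d; rewrite -[k']anc_depth -(anc_prefix ki) // (anc_prefix mi) //.
exact: anc_mem.
Qed.

Lemma descendantsP i m : descendants T i m <-> i \in clan T m /\ i != m.
Proof.
split=> [[im ic]|[ic im]]; split=> //; first by apply/eqP=> e; rewrite e ltnn in im.
have : anc m (depth i) < anc m (depth m).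
  apply: (sorted_ltn_nth (leT := fun k m : 'I_n.+1 => k < m)).
  - by move=> x y z; exact: ltn_trans.
  - exact: clan_sorted.
  - by rewrite inE ltn_clan depth_le.
  - by rewrite inE ltn_clan.
  - exact: depth_lt.
by rewrite (anc_prefix ic) // !anc_depth.
Qed.

Lemma descendants_trans i k m :
  descendants T i k -> descendants T k m -> descendants T i m.
Proof.
move=> [ik ic] [km kc]; split; first exact: ltn_trans km.
exact: clan_trans ic.
Qed.

Lemma clan_descendants i m : i \in clan T m <-> m = i \/ descendants T i m.
Proof.
split=> [im|[->|[]//]]; last exact: clan_self.
by case: (eqVneq i m) => [->|ne]; [left|right; apply/descendantsP].
Qed.

Definition proper_support i l := forall k, l k != 0 -> k \in clan T i /\ k != i.

Lemma proper_support_clan i k l :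
  k \in clan T i -> proper_support k l -> proper_support i l.
Proof.
move=> ki sl m /sl[mk mnk]; split; first exact: clan_trans mk.
apply: contraTneq (leq_trans (depth_lt mk mnk) (depth_le ki)) => ->.
by rewrite ltnn.
Qed.

Lemma proper_support0 k i a l : proper_support k l -> k \in clan T i ->
  depth k <= a -> a < depth i -> l (anc i a) = 0.
Proof.
move=> sl ki ka ai; apply/eqP; apply/negP => /negP /sl[mk mnk].
by have := depth_lt mk mnk; rewrite depth_anc ?(ltnW ai) //; lia.
Qed.

(** This is what makes all but one term of a bracket vanish. *)
Lemma proper_support_above i k l : proper_support k l -> k \in clan T i -> l i = 0.
Proof.
move=> sl ki; apply/eqP; apply/negP => /negP /sl[ik ink].
by have := depth_lt ik ink; have := depth_le ki; lia.
Qed.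

Lemma clan_prod_cat i a b c : a <= b -> b <= c ->
  clan_prod T i a c = clan_prod T i a b * clan_prod T i b c.
Proof. exact: big_cat_nat. Qed.

Lemma clan_prod_prefix i k a b : k \in clan T i -> b <= depth k ->
  clan_prod T i a b = clan_prod T k a b.
Proof.
move=> ki bk; apply: eq_big_nat => c /andP[_ cb].
by rewrite !(anc_prefix ki) //; lia.
Qed.

Lemma clan_prod_gt0 i a b : b <= depth i -> 0 < clan_prod T i a b.
Proof.
move=> bi; rewrite /clan_prod big_nat_cond; apply: prodn_cond_gt0 => c /andP[/andP[_ cb] _].
by apply: edge_mult_gt0; apply: edge_anc; lia.
Qed.

(** Every node but the root has a parent, and the last factor of the products
    along its clan is the multiplicity of the edge from this parent. *)
Lemma parentP k : 0 < depth k -> exists p,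
  [/\ edge T p k, p \in clan T k, p != k, depth k = (depth p).+1 &
  forall a, a <= depth p ->
    clan_prod T k a (depth k) = clan_prod T k a (depth p) * edge_mult T p k].
Proof.
move=> dk; set p := anc k (depth k).-1.
have pk : edge T p k.
  by have := @edge_anc k (depth k).-1; rewrite prednK // anc_depth; apply.
have dp : depth k = (depth p).+1 by rewrite depth_anc ?leq_pred // prednK.
exists p; split=> //; first by apply: anc_mem; exact: leq_pred.
  by apply: anc_neq; rewrite prednK.
move=> a ap; rewrite (@clan_prod_cat k a (depth p) (depth k)) ?dp //; congr muln.
by rewrite /clan_prod big_nat1 -dp anc_depth -[depth p]/(depth p).+1.-1 -dp.
Qed.

Lemma clan_prod_nil i a : clan_prod T i a a = 1.
Proof. by rewrite /clan_prod big_geq. Qed.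

Lemma weight_geq i l a : depth i <= a -> weight T i l a = 0.
Proof. by move=> ia; rewrite /weight big_geq. Qed.

(** The recursion that turns the comparison of exponents into that of
    sequences w with w_a >= d_a w_(a+1). *)
Lemma weight_rec i l a : a < depth i -> weight T i l a =
  l (anc i a) + edge_mult T (anc i a) (anc i a.+1) * weight T i l a.+1.
Proof.
move=> ai; rewrite /weight big_ltn // clan_prod_nil muln1; congr addn.
rewrite big_distrr /=; apply: eq_big_nat => e /andP[ae ei].
by rewrite [clan_prod _ _ _ _]big_ltn // mulnCA.
Qed.

Lemma weightD i l j a : weight T i (l + j)%MM a = weight T i l a + weight T i j a.
Proof. by rewrite /weight -big_split; apply: eq_bigr => e _; rewrite mnmDE mulnDl. Qed.

Lemma weight0 i a : weight T i 0%MM a = 0.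
Proof. by rewrite /weight big1 // => e _; rewrite mnm0E. Qed.

Lemma weightMn i l c a : weight T i (l *+ c)%MM a = c * weight T i l a.
Proof.
by rewrite /weight big_distrr; apply: eq_bigr => e _; rewrite mulmnE mulnAC mulnC.
Qed.

(** Extension by zeros keeps all weights, including those at positions beyond
    the smaller clan, which are zero on both sides. *)
Lemma weight_clan i k l a : k \in clan T i -> proper_support k l ->
  weight T i l a = weight T k l a.
Proof.
move=> ki sl; have dk := depth_le ki.
have Z b : depth k <= b -> weight T i l b = 0.
  move=> kb; rewrite /weight big_nat_cond big1 // => e /andP[/andP[be ei] _].
  by rewrite (proper_support0 sl ki) //; lia.
case: (leqP a (depth k)) => ak; last by rewrite Z ?weight_geq //; lia.
rewrite {1}/weight (big_cat_nat ak dk) /= [X in _ + X]big_nat_cond [X in _ + X]big1 ?addn0.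
  rewrite /weight; apply: eq_big_nat => e /andP[_ ek].
  by rewrite (anc_prefix ki) ?(clan_prod_prefix _ ki) //; lia.
move=> e /andP[/andP[ke ei] _].
by rewrite (proper_support0 sl ki).
Qed.

Lemma weight_mnm1 i k a : k \in clan T i -> k != i ->
  weight T i U_(k)%MM a = if a <= depth k then clan_prod T i a (depth k) else 0.
Proof.
move=> ki kni; have dk := depth_lt ki kni.
have E e : e < depth i -> (U_(k)%MM : 'X_{1..n.+1}) (anc i e) = (e == depth k).
  move=> ei; rewrite mnm1E -[in LHS](anc_depth k) -(anc_prefix ki) //.
  by rewrite nth_uniq ?clan_uniq ?ltn_clan ?(ltnW dk) ?(ltnW ei) 1?eq_sym.
case: leqP => ak.
  rewrite /weight (big_cat_nat ak (ltnW dk)) /= big_nat_cond big1 ?add0n; last first.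
    by move=> e /andP[/andP[ae ek] _]; rewrite E; [case: eqP => //|]; lia.
  rewrite big_ltn // E // eqxx mul1n big_nat_cond big1 ?addn0 // => e.
  by move=> /andP[/andP[ae ek] _]; rewrite E; [case: eqP => //|]; lia.
rewrite /weight big_nat_cond big1 // => e /andP[/andP[ae ek] _].
by rewrite E; [case: eqP => //|]; lia.
Qed.

Lemma weight_ge i l a : a <= depth i ->
  clan_prod T i 0 a * weight T i l a <= weight T i l 0.
Proof.
elim: a => [|a IH] ai; first by rewrite clan_prod_nil mul1n.
apply: leq_trans (IH (ltnW ai)).
rewrite (weight_rec l ai) (@clan_prod_cat i 0 a a.+1) //.
by rewrite {2}/clan_prod big_nat1 -mulnA leq_mul2l leq_addl orbT.
Qed.

(** The bound that defines R_i only concerns the weight at the root, but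
    w_0 >= d_0 ... d_(a-1) w_a turns it into the corresponding bound at each
    position. *)
Lemma Rset_weight i l a : Rset T i l -> a <= depth i ->
  weight T i l a <= clan_prod T i a (depth i).
Proof.
move=> [_ wl] ai; rewrite -(@leq_pmul2l (clan_prod T i 0 a)) ?clan_prod_gt0 //.
rewrite -clan_prod_cat //; exact: leq_trans (weight_ge _ _) wl.
Qed.

Lemma precE i l j : prec T i l j <-> forall a, weight T i l a <= weight T i j a.
Proof.
split=> H a; last by move=> _; exact: H.
by case: (ltnP a (depth i)) => [/H //|ia]; rewrite weight_geq.
Qed.

Lemma prec_refl i l : prec T i l l. Proof. by move=> a. Qed.

Lemma prec_trans i l j (h : 'X_{1..n.+1}) :
  prec T i l j -> prec T i j h -> prec T i l h.
Proof. by move=> lj jm a ai; exact: leq_trans (lj a ai) (jm a ai). Qed.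

(** Weights determine the exponent, as l_a = w_a - d_a w_(a+1); this gives the
    antisymmetry of the order. *)
Lemma weight_inj i l j : proper_support i l -> proper_support i j ->
  (forall a, weight T i l a = weight T i j a) -> l = j.
Proof.
move=> sl sj w; apply/mnmP => k.
case: (boolP ((k \in clan T i) && (k != i))) => [/andP[ki kni]|nk]; last first.
  suff Z h : proper_support i h -> h k = 0 by rewrite !Z.
  by move=> sh; apply/eqP; apply/negP => /negP /sh[] ki kni; rewrite ki kni in nk.
have dk := depth_lt ki kni.
have := w (depth k); rewrite (weight_rec l dk) (weight_rec j dk) w => /addIn.
by rewrite (anc_prefix ki) // anc_depth.
Qed.

Lemma prec_anti i l j : proper_support i l -> proper_support i j ->
  prec T i l j -> prec T i j l -> l = j.
Proof.
move=> sl sj /precE lj /precE jl; apply: (weight_inj sl sj) => a.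
by apply/eqP; rewrite eqn_leq lj jl.
Qed.

Lemma Rset_clan i k l : k \in clan T i -> Rset T k l -> Rset T i l.
Proof.
move=> ki [sl wl]; split; first exact: proper_support_clan sl.
rewrite (weight_clan _ ki) // (leq_trans wl) //.
rewrite (@clan_prod_cat i 0 (depth k)) ?depth_le // (clan_prod_prefix _ ki) //.
by rewrite leq_pmulr // clan_prod_gt0.
Qed.

Lemma prec_clan i k l j : k \in clan T i ->
  proper_support k l -> proper_support k j -> prec T k l j -> prec T i l j.
Proof.
move=> ki sl sj /precE H; apply/precE => a.
by rewrite !(weight_clan _ ki).
Qed.

(** R_k is closed downwards in R_i: the weights of j vanish from the depth of
    k on, hence so do those of any l below j. *)
Lemma prec_restrict i k l j : k \in clan T i -> proper_support i l ->
  Rset T k j -> prec T i l j -> Rset T k l /\ prec T k l j.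
Proof.
move=> ki sl [sj wj] /precE lj.
have skl : proper_support k l.
  move=> m lm; have [mi mni] := sl m lm.
  have dm := depth_lt mi mni; have anc_m : anc i (depth m) = m.
    by rewrite (anc_prefix mi) ?anc_depth.
  have mk : depth m < depth k.
    rewrite ltnNge; apply/negP => km; have := lj (depth m).
    rewrite (weight_clan _ ki sj) [X in _ <= X]weight_geq // (weight_rec l dm) anc_m.
    by move: lm; lia.
  split; first by rewrite -anc_m (anc_prefix ki) ?(anc_mem (ltnW _)) // ltnW.
  by apply: contraTneq mk => ->; rewrite ltnn.
have lj' a : weight T k l a <= weight T k j a by rewrite -!(weight_clan _ ki).
by split; [split=> //; exact: leq_trans wj|apply/precE].
Qed.

Lemma Rset0 i : Rset T i 0%MM.
Proof. by split=> [k|]; rewrite ?mnm0E ?weight0. Qed.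

Lemma Rset_mnm1 i k : k \in clan T i -> k != i -> Rset T i U_(k)%MM.
Proof.
move=> ki kni; split=> [m|].
  by rewrite mnm1E; case: (k =P m) => [<-|].
rewrite weight_mnm1 // (@clan_prod_cat i 0 (depth k) (depth i)) ?depth_le //.
by rewrite leq_pmulr // clan_prod_gt0.
Qed.

(** The exponent [j + (l - U_(k))] is that of the bracket of x^j d_k with
    x^l d_i, where a factor x_k is traded for x^j. *)
Lemma weight_step i k l j a : l k != 0 ->
  weight T i (j + (l - U_(k)))%MM a + weight T i U_(k)%MM a =
  weight T i j a + weight T i l a.
Proof. by move=> lk; rewrite -!weightD -addmA submK // lep1mP. Qed.

(** A trade cannot raise any weight: at position a the factor x_k weighs
    exactly the bound that [Rset_weight] puts on the elements of R_k. *)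
Lemma prec_step i k l j : proper_support i l -> l k != 0 -> Rset T k j ->
  prec T i (j + (l - U_(k)))%MM l.
Proof.
move=> sl lk Rj; have [ki kni] := sl k lk; have [sj _] := Rj.
apply/precE => a; rewrite -(leq_add2r (weight T i U_(k)%MM a)) weight_step //.
rewrite addnC leq_add2l (weight_clan _ ki) // weight_mnm1 //.
case: (leqP a (depth k)) => ak; last by rewrite weight_geq // ltnW.
by rewrite (clan_prod_prefix _ ki) //; exact: Rset_weight.
Qed.

Lemma proper_support_step i k l j : proper_support i l -> l k != 0 ->
  Rset T k j -> proper_support i (j + (l - U_(k)))%MM.
Proof.
move=> sl lk [sj _] m; have [ki kni] := sl k lk.
rewrite mnmDE mnmBE => jl.
case: (eqVneq (j m) 0) => [jm|jm]; last exact: (proper_support_clan ki sj).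
by apply: sl; move: jl; rewrite jm; lia.
Qed.

Lemma Rset_prec i l j : proper_support i l -> Rset T i j -> prec T i l j -> Rset T i l.
Proof.
move=> sl [sj wj] /precE lj; split=> //; exact: leq_trans (lj 0) wj.
Qed.

Lemma Rset_step i k l j : Rset T i l -> l k != 0 -> Rset T k j ->
  Rset T i (j + (l - U_(k)))%MM.
Proof.
move=> Rl lk Rj; have [sl _] := Rl; apply: (Rset_prec _ Rl).
  exact: proper_support_step.
exact: prec_step.
Qed.

(** The exponent of the generator that ends in d_k attains all the bounds of
    [Rset_weight] and is therefore the largest element of R_k.  Trading x_k for
    it keeps all weights but the one at k, which drops by one. *)
Lemma Rset_top k : exists g, [/\ Rset T k g,
  k = ord0 /\ g = 0%MM \/ (exists2 p, edge T p k & g = (U_(p) *+ edge_mult T p k)%MM) &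
  forall a, weight T k g a = if a < depth k then clan_prod T k a (depth k) else 0].
Proof.
case: (posnP (depth k)) => dk.
  exists 0%MM; split; first exact: Rset0.
    by left; split=> //; have := anc_depth k; rewrite dk; have [q -> _] := clanP k.
  by move=> a; rewrite weight0 dk.
have [p [pk pc pn dp prodp]] := parentP dk.
have W a : weight T k (U_(p) *+ edge_mult T p k)%MM a =
    if a < depth k then clan_prod T k a (depth k) else 0.
  rewrite weightMn weight_mnm1 // dp ltnS -dp; case: leqP => ap; last by rewrite muln0.
  by rewrite prodp // mulnC.
exists (U_(p) *+ edge_mult T p k)%MM; split=> //; last by right; exists p.
split=> [m|]; last by rewrite W dk.
by rewrite mulmnE mnm1E; case: (p =P m) => [<-|].
Qed.

(** Trades reach everything below: at the deepest position a where the weights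
    of l and l' differ, w_a(l) > w_a(l') >= d_a w_(a+1)(l') = d_a w_(a+1)(l),
    so that x_a occurs in x^l and can be traded for the generator, which lowers
    w_a by one and leaves l above l'. *)
Lemma descent (A : set 'X_{1..n.+1}) i :
  (forall l k j, A l -> l k != 0 -> Rset T k j -> A (j + (l - U_(k)))%MM) ->
  forall l l', proper_support i l -> proper_support i l' -> A l ->
  prec T i l' l -> A l'.
Proof.
move=> Astep l l'; move Ew : (\sum_(0 <= a < depth i) weight T i l a) => w.
elim/ltn_ind: w l Ew => w IH l Ew sl sl' Al /precE l'l.
have [->//|nl] := eqVneq l' l.
pose P a := (a < depth i) && (weight T i l' a < weight T i l a).
have exP : exists a, P a.
  apply: contrapT => nP; case/eqP: nl; apply: (weight_inj sl' sl) => a.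
  apply/eqP; rewrite eqn_leq l'l /= leqNgt; apply/negP => aw; apply: nP.
  exists a; rewrite /P aw andbT ltnNge; apply/negP => ia.
  by move: aw; rewrite !weight_geq.
have ubP a : P a -> a <= depth i by case/andP => /ltnW.
case: (ex_maxnP exP ubP) => a /andP[ai aw] amax.
set k := anc i a; have ki : k \in clan T i by apply: anc_mem; exact: ltnW.
have kn : k != i by exact: anc_neq.
have dk : depth k = a by rewrite depth_anc // ltnW.
have wS : weight T i l' a.+1 = weight T i l a.+1.
  apply/eqP; rewrite eqn_leq l'l leqNgt; apply/negP => aw'.
  suff /amax : P a.+1 by rewrite ltnn.
  rewrite /P aw' andbT ltnNge; apply/negP => ia.
  by move: aw'; rewrite !weight_geq.
have lk : l k != 0.
  by move: aw; rewrite (weight_rec l ai) (weight_rec l' ai) wS -/k; lia.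
have [g [Rg _ wg]] := Rset_top k.
have wstep b : weight T i (g + (l - U_(k)))%MM b + (b == a) = weight T i l b.
  have := weight_step i g b lk; have [sg _] := Rg.
  rewrite (weight_clan _ ki sg) wg weight_mnm1 // dk.
  case: (ltngtP b a) => ba; rewrite ?ba; last 2 first.
  - by rewrite /= !addn0 add0n.
  - by rewrite clan_prod_nil.
  have -> : clan_prod T k b a = clan_prod T i b a by rewrite (clan_prod_prefix _ ki) // dk.
  by rewrite addn0 addnC; apply: addnI.
apply: (IH _ _ (g + (l - U_(k)))%MM erefl) => //.
- rewrite -Ew; set u := (g + _)%MM.
  rewrite [X in _ < X](eq_bigr (fun b => weight T i u b + (b == a))); last first.
    by move=> b _; rewrite wstep.
  rewrite big_split /= -[X in X < _]addn0 ltn_add2l.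
  by rewrite (bigD1_seq a) ?iota_uniq //= ?mem_index_iota ?ai // eqxx; lia.
- exact: proper_support_step.
- exact: Astep.
- apply/precE => b; have := wstep b; have := l'l b.
  by case: eqP => [->|]; lia.
Qed.

Lemma Rset_top_prec k g l : (forall a, weight T k g a =
    if a < depth k then clan_prod T k a (depth k) else 0) ->
  Rset T k l -> prec T k l g.
Proof. by move=> wg Rl a ak; rewrite wg ak; apply: Rset_weight Rl (ltnW ak). Qed.

(** Weights on R_i are bounded by [Rset_weight], so increasing chains stop. *)
Lemma maximal_above (A : set 'X_{1..n.+1}) i l : A `<=` Rset T i -> A l ->
  exists2 h, A h /\ prec T i l h & forall h', A h' -> prec T i h h' -> h' = h.
Proof.
move=> AR; pose B := \sum_(0 <= a < depth i) clan_prod T i a (depth i).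
move Ew : (B - \sum_(0 <= a < depth i) weight T i l a) => w.
elim/ltn_ind: w l Ew => w IH l Ew Al.
have [[h' [Ah' lh' ne]]|nex] := pselect (exists h', [/\ A h', prec T i l h' & h' <> l]).
  have [|m [Am mh'] max] := IH _ _ h' erefl Ah'.
    rewrite -Ew; have bnd h : A h -> \sum_(0 <= a < depth i) weight T i h a <= B.
      move=> Ah; rewrite /B !big_nat; apply: leq_sum => a /andP[_ ai].
      by apply: Rset_weight (ltnW ai); exact: AR.
    have /bnd := Ah'; suff : \sum_(0 <= a < depth i) weight T i l a <
        \sum_(0 <= a < depth i) weight T i h' a by lia.
    rewrite ltnNge; apply/negP => le.
    apply: ne; apply/esym; have [sl _] := AR _ Al; have [sh' _] := AR _ Ah'.
    apply: (prec_anti sl sh' lh') => a ai.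
    move/precE: lh' => lh'; rewrite leqNgt; apply/negP => la.
    move: le; rewrite leqNgt => /negP; apply.
    rewrite (bigD1_seq a) ?iota_uniq ?mem_index_iota ?ai //=.
    rewrite [X in _ < X](bigD1_seq a) ?iota_uniq ?mem_index_iota ?ai //=.
    by rewrite -addSn leq_add // leq_sum // => b _; exact: lh'.
  by exists m => //; split=> //; apply: prec_trans mh'.
exists l; first by split=> //; exact: prec_refl.
move=> h' Ah' lh'; apply: contrapT => ne; apply: nex.
by exists h'.
Qed.

Lemma Upsilon_descendants i k : Upsilon T i -> descendants T i k -> Upsilon T k.
Proof. by move=> Ui ik m km; apply: Ui; exact: descendants_trans km. Qed.

Lemma multiplicity_free_edge p i :
  multiplicity_free T i -> edge T p i -> edge_mult T p i = 1.
Proof.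
by move=> [q [_ qi <-]] pi; rewrite (edge_unique pi qi).
Qed.

(** Below a node of Upsilon all multiplicities are 1, so that R_k is bounded by
    the same number as R_i. *)
Lemma Upsilon_prod i k a : Upsilon T i -> i \in clan T k ->
  a <= depth i -> clan_prod T k a (depth k) = clan_prod T i a (depth i).
Proof.
move=> Ui ik ai; rewrite (@clan_prod_cat k a (depth i)) ?depth_le //.
rewrite (clan_prod_prefix _ ik) // [X in _ * X]big_nat_cond big1 ?muln1 //.
move=> b /andP[/andP[ib bk] _]; apply: multiplicity_free_edge (edge_anc bk).
apply: Ui; apply/descendantsP; set m := anc k b.+1.
have mk : m \in clan T k by exact: anc_mem.
have dm : depth m = b.+1 by rewrite depth_anc.
have im : depth i < depth m by rewrite dm ltnS.
split; last by apply: contraTneq im => ->; rewrite ltnn.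
rewrite -{1}(anc_depth i) -(anc_prefix ik) // (anc_prefix mk) ?(ltnW im) //.
by apply: anc_mem; exact: ltnW.
Qed.

Lemma weight_eq0 i l : proper_support i l -> weight T i l 0 = 0 -> l = 0%MM.
Proof.
move=> sl w0; apply: (@weight_inj i) => // [k|a]; first by rewrite mnm0E.
rewrite weight0; case: (leqP a (depth i)) => [ai|/ltnW]; last exact: weight_geq.
by have := weight_ge l ai; rewrite w0 leqn0 muln_eq0 (gtn_eqF (clan_prod_gt0 _ ai)) => /eqP.
Qed.

(** A single factor x_s already uses up the bound on R_k. *)
Lemma Upsilon_Rset s k j : Upsilon T s -> Rset T k j ->
  descendants T s k -> j s != 0 -> j = U_(s)%MM.
Proof.
move=> Us [sj wj] /descendantsP[sk sn] js.
have le : (U_(s) <= j)%MM by rewrite lep1mP.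
rewrite -(submK le); suff -> : (j - U_(s))%MM = 0%MM by rewrite addmC addm0.
apply: (@weight_eq0 k) => [m|]; first by rewrite mnmBE => jm; apply: sj; move: jm; lia.
move: wj; rewrite -{1}(submK le) weightD weight_mnm1 //= (Upsilon_prod Us) //.
by rewrite (clan_prod_prefix _ sk) //; lia.
Qed.

End Combinatorics.
(** * Subspaces and spans *)

Section Span.
Variables (F : fieldType) (V : lmodType F).
Implicit Types (U X Y : set V) (u v : V).

Lemma subspaceP U :
  subspace U <-> U 0 /\ forall (a : F) u v, U u -> U v -> U (a *: u + v).
Proof.
split=> [[U0 UL]|[U0 UL]]; split.
- by move: U0; rewrite inE.
- by move=> a u v Uu Uv; have := UL a u v; rewrite !inE; apply.
- by rewrite inE.
- by move=> a u v; rewrite !inE; exact: UL.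
Qed.

Lemma subspace0 U : subspace U -> U 0.
Proof. by case/subspaceP. Qed.

Lemma subspaceD U u v : subspace U -> U u -> U v -> U (u + v).
Proof. by move=> /subspaceP[_ UL] Uu Uv; rewrite -[u]scale1r; exact: UL. Qed.

Lemma subspaceZ U (a : F) u : subspace U -> U u -> U (a *: u).
Proof. by move=> /subspaceP[U0 UL] Uu; rewrite -[a *: u]addr0; exact: UL. Qed.

Lemma subspaceN U u : subspace U -> U u -> U (- u).
Proof. by move=> sU Uu; rewrite -scaleN1r; exact: subspaceZ. Qed.

Lemma subspaceB U u v : subspace U -> U u -> U v -> U (u - v).
Proof. by move=> sU Uu Uv; apply: subspaceD => //; exact: subspaceN. Qed.

Lemma subspace_set1 : subspace [set 0 : V].
Proof.
by apply/subspaceP; split=> [//|a u v -> ->]; rewrite scaler0 addr0.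
Qed.

Lemma subspace_lspan X : subspace (lspan X).
Proof.
apply/subspaceP; split=> [U sU _|a u v uX vX U sU XU]; first exact: subspace0.
by apply: subspaceD => //; [apply: subspaceZ => //; exact: uX|exact: vX].
Qed.

Lemma sub_lspan X : X `<=` lspan X.
Proof. by move=> v Xv U _; exact. Qed.

Lemma lspan_le X U : subspace U -> X `<=` U -> lspan X `<=` U.
Proof. by move=> sU XU v; exact. Qed.

End Span.

(** * Monomial operators and their brackets *)

Section Operators.
Variables (F : fieldType) (n : nat).
Local Notation op := (mpoly_op F n).
Implicit Types (A B : op) (l j : 'X_{1..n}) (k s : 'I_n).

Lemma submm l : (l - l)%MM = 0%MM.
Proof. by apply/mnmP => i; rewrite mnmBE subnn mnm0E. Qed.

(** A and B are arbitrary maps, and A \o (B + C) splits only if A is additive. *)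
Lemma bracketDr A a B C : linear A ->
  bracket A (a *: B + C) = a *: bracket A B + bracket A C.
Proof.
move=> lA; apply/funext => f; rewrite /bracket !fctE lA scalerBr.
by rewrite opprD addrACA.
Qed.

Lemma bracket0r A : linear A -> bracket A 0 = 0.
Proof.
by move=> lA; have := bracketDr (-1) 0 0 lA; rewrite scaler0 addr0 scaleN1r addNr.
Qed.

Lemma bracket_sumr (J : Type) (q : seq J) A (B : J -> op) : linear A ->
  bracket A (\sum_(c <- q) B c) = \sum_(c <- q) bracket A (B c).
Proof.
move=> lA; apply: (big_morph (bracket A)) => [B1 B2|]; last exact: bracket0r.
by have := bracketDr 1 B1 B2 lA; rewrite !scale1r.
Qed.

Lemma bracketZr A a B : linear A -> bracket A (a *: B) = a *: bracket A B.
Proof.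
by move=> lA; have := bracketDr a B 0 lA; rewrite bracket0r // !addr0.
Qed.

Lemma bracket_linear_subspace A (Z : set op) : linear A -> subspace Z ->
  subspace [set B | Z (bracket A B)].
Proof.
move=> lA sZ; apply/subspaceP; split=> [|a B C ZB ZC] /=.
  by rewrite bracket0r //; exact: subspace0.
by rewrite bracketDr //; apply: subspaceD => //; exact: subspaceZ.
Qed.

Lemma bracketN A B : bracket A B = - bracket B A.
Proof. by rewrite /bracket opprB. Qed.

Lemma lspan_linear (X : set op) B :
  (forall A, X A -> linear A) -> lspan X B -> linear B.
Proof.
move=> lX; move: B; apply: lspan_le => //; apply/subspaceP; split.
  by move=> a f g; rewrite -[RHS]/(a *: 0 + 0) scaler0 addr0.
move=> c A B lA lB a f g; rewrite !fctE lA lB !scalerDr !scalerA [a * c]mulrC.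
by rewrite addrACA.
Qed.

Lemma bracket_lspan (X Y : set op) (Z : set op) :
  (forall A, X A -> linear A) -> (forall B, Y B -> linear B) -> subspace Z ->
  (forall A B, X A -> Y B -> Z (bracket A B)) ->
  forall A B, lspan X A -> lspan Y B -> Z (bracket A B).
Proof.
move=> lX lY sZ XYZ.
have W A : X A -> forall B, lspan Y B -> Z (bracket A B).
  move=> XA; apply: lspan_le => [|B YB]; last exact: XYZ.
  by apply: bracket_linear_subspace => //; exact: lX.
move=> A B XA YB; move: A XA; apply: lspan_le => [|A XA]; last exact: W.
have := bracket_linear_subspace (lspan_linear lY YB) sZ.
rewrite (_ : [set _ | _] = [set A | Z (bracket A B)]) //.
apply/seteqP; split=> A /= ZA; rewrite bracketN; exact: subspaceN.
Qed.

Lemma monomial_deriv_linear l s : linear (@monomial_deriv F n l s).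
Proof. by move=> a f g; rewrite /monomial_deriv linearP mulrDr scalerAr. Qed.

Lemma monomial_deriv_diffop l s : diffop (@monomial_deriv F n l s).
Proof. exact: (diffop_comp (diffop_mul 'X_[l]) (diffop_deriv F s)). Qed.

Lemma diffop_subspace : subspace (@diffop F n).
Proof.
apply/subspaceP; split.
  rewrite (_ : 0 = (fun f => 0 * f) :> op); first exact: diffop_mul.
  by apply/funext => f; rewrite mul0r.
move=> a A B dA dB; apply: diffop_add => //.
rewrite (_ : a *: A = (fun f => a%:MP * f) \o A); last first.
  by apply/funext => f; rewrite /= mul_mpolyC.
by apply: diffop_comp => //; exact: diffop_mul.
Qed.

Lemma monomial_deriv0 s : @monomial_deriv F n 0%MM s = mderiv s.
Proof. by apply/funext => f; rewrite /monomial_deriv mpolyX0 mul1r. Qed.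

Lemma bracket_monomial_deriv l j k s :
  bracket (@monomial_deriv F n j k) (monomial_deriv l s) =
  (l k)%:R *: monomial_deriv (j + (l - U_(k)))%MM s -
  (j s)%:R *: monomial_deriv (l + (j - U_(s)))%MM k.
Proof.
apply/funext => f; rewrite /bracket /monomial_deriv !fctE /= !mderivM !mderivX.
rewrite !mulrDr mderiv_comm !mpolyXD -!scalerAl -!scalerAr !mulrA.
by rewrite ['X_[l] * 'X_[j]]mulrC opprD addrACA subrr addr0.
Qed.

(** The action on the variables is enough to tell monomial operators apart:
    the coefficients of A x_s are those of the component of A along d_s. *)
Lemma mcoeff_monomial_deriv l s j k :
  (@monomial_deriv F n l s 'X_k)@_j = ((l == j) && (s == k))%:R.
Proof.
rewrite /monomial_deriv mderivX mnm1E eq_sym; case: (s =P k) => [->|] /=.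
  by rewrite scale1r submm mpolyX0 mulr1 andbT mcoeffX.
by rewrite scale0r mulr0 mcoeff0 andbF.
Qed.

Lemma monomial_deriv_neq0 l s : @monomial_deriv F n l s <> 0.
Proof.
move=> e; have := mcoeff_monomial_deriv l s l s; rewrite e !eqxx.
by rewrite -[0 'X_s]/(0 : {mpoly F[n]}) mcoeff0 => /eqP; rewrite eq_sym oner_eq0.
Qed.

Definition monomial_ops (A : 'I_n -> set 'X_{1..n}) : set op :=
  [set B | exists s l, A s l /\ B = @monomial_deriv F n l s].

Lemma monomial_ops_linear (A : 'I_n -> set 'X_{1..n}) B : monomial_ops A B -> linear B.
Proof. by move=> [s [l [_ ->]]]; exact: monomial_deriv_linear. Qed.

Lemma lspan_monomial_deriv (A : 'I_n -> set 'X_{1..n}) l s :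
  lspan (monomial_ops A) (monomial_deriv l s) -> A s l.
Proof.
move=> h; apply: contrapT => nA.
pose U := [set B : op | (B 'X_s)@_l = 0].
have : U (monomial_deriv l s).
  apply: h.
    apply/subspaceP; split=> [|a B C UB UC]; first exact: mcoeff0.
    by rewrite /U /= !fctE mcoeffD mcoeffZ UB UC mulr0 addr0.
  move=> _ [k [j [Aj ->]]]; rewrite /U /= mcoeff_monomial_deriv.
  by case: eqP Aj => //= ->; case: eqP => // ->.
by rewrite /U /= mcoeff_monomial_deriv !eqxx => /eqP; rewrite oner_eq0.
Qed.

Lemma monomial_spanP (A : 'I_n -> set 'X_{1..n}) B : lspan (monomial_ops A) B ->
  exists2 q : seq (F * ('X_{1..n} * 'I_n)),
    (forall c, c \in q -> A c.2.2 c.2.1) &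
    B = \sum_(c <- q) c.1 *: monomial_deriv c.2.1 c.2.2.
Proof.
move: B; apply: lspan_le => [|_ [s [l [Al ->]]]]; last first.
  exists [:: (1, (l, s))]; last by rewrite big_seq1 scale1r.
  by move=> c; rewrite inE => /eqP ->.
apply/subspaceP; split; first by exists [::] => [c|]; rewrite ?in_nil ?big_nil.
move=> a _ _ [q qA ->] [t tA ->].
exists ([seq (a * c.1, c.2) | c <- q] ++ t).
  move=> c; rewrite mem_cat => /orP[/mapP[d dq ->]|]; [exact: (qA d)|exact: tA].
rewrite big_cat big_map scaler_sumr /=; congr (_ + _).
by apply: eq_bigr => c _; rewrite scalerA.
Qed.

End Operators.
(** * The Lie algebras of a tree diagram *)

Section TreeLieAlgebra.
Variables (F : numFieldType) (n : nat) (T : tree_diagram n).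
Local Notation op := (mpoly_op F n.+1).
Local Notation D l s := (@monomial_deriv F n.+1 l s).
Implicit Types (i k m p s r : 'I_n.+1) (l j : 'X_{1..n.+1}) (A B : op).

(** The other term of the bracket vanishes since x^j only involves ancestors
    of k.  Characteristic zero allows dividing by l_k. *)
Lemma bracket_ancestor (Z : set op) l j k s : subspace Z ->
  proper_support T k j -> k \in clan T s -> l k != 0%N ->
  Z (bracket (D j k) (D l s)) -> Z (D (j + (l - U_(k)))%MM s).
Proof.
move=> sZ sj ks lk; rewrite bracket_monomial_deriv (proper_support_above sj ks).
rewrite scale0r subr0 => /(subspaceZ (l k)%:R^-1 sZ).
by rewrite scalerA mulVf ?pnatr_eq0 // scale1r.
Qed.

(** The generator that ends in d_i carries the largest exponent of R_i, and
    brackets with the x^j d_k at the proper ancestors k of i, available by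
    induction, perform the trades of [descent]. *)
Lemma L0_monomial i l : Rset T i l -> L0 F T (D l i).
Proof.
move=> Rl L lL XL; have [_ sL brL] := lL.
elim/ltn_ind: {i}(i : nat) {-2}i (erefl (i : nat)) l Rl => d IH i di l Rl.
have [g [Rg gen wg]] := Rset_top T i.
have Lg : L (D g i).
  apply: XL; case: gen => [[-> ->]|[p pi ->]]; last by right; exists p, i.
  by left; exact: monomial_deriv0.
have [sg _] := Rg; have [sl _] := Rl.
pose A := [set l | proper_support T i l /\ L (D l i)].
have step h k j : A h -> h k != 0%N -> Rset T k j -> A (j + (h - U_(k)))%MM.
  move=> [sh Lh] hk Rj; have [ki kni] := sh k hk.
  split; first exact: proper_support_step.
  have [sj _] := Rj; apply: bracket_ancestor => //; apply: brL => //.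
  have /descendantsP[lt _] := conj ki kni.
  by apply: (IH (k : nat)) => //; rewrite -di.
have [] // := descent step sg sl (conj sg Lg).
exact: Rset_top_prec.
Qed.

(** The span is closed under brackets since trades stay inside R_s. *)
Lemma L0_span : L0 F T `<=` lspan (monomial_ops (Rset T)).
Proof.
move=> A; apply; last first.
  move=> _ [->|[i [j [ij ->]]]]; apply: sub_lspan.
    by exists ord0, 0%MM; split; [exact: Rset0|rewrite monomial_deriv0].
  exists j, (U_(i) *+ edge_mult T i j)%MM; split=> //.
  have [g [Rg gen _]] := Rset_top T j; move: gen Rg => [[j0]|[p pj ->]].
    by have := edge_lt ij; rewrite j0.
  by rewrite (edge_unique ij pj).
split; [|exact: subspace_lspan|].
  apply: (lspan_le (@diffop_subspace F n.+1)).
  by move=> _ [s [l [_ ->]]]; exact: monomial_deriv_diffop.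
have lin := @monomial_ops_linear F n.+1 (Rset T).
apply: (bracket_lspan lin lin (subspace_lspan _)).
have Z s k l j : Rset T s l -> Rset T k j ->
    lspan (monomial_ops (Rset T)) ((l k)%:R *: D (j + (l - U_(k)))%MM s).
  move=> Rl Rj; case: (eqVneq (l k) 0%N) => [->|lk].
    by rewrite scale0r; apply: subspace0; exact: subspace_lspan.
  apply: (subspaceZ _ (subspace_lspan _)).
  by apply: sub_lspan; exists s, (j + (l - U_(k)))%MM; split=> //; exact: Rset_step.
move=> _ _ [k [j [Rj ->]]] [s [l [Rl ->]]]; rewrite bracket_monomial_deriv.
exact: (subspaceB (subspace_lspan _) (Z _ _ _ _ Rl Rj) (Z _ _ _ _ Rj Rl)).
Qed.

Lemma Hspace_subspace : subspace (@Hspace F n).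
Proof. exact: subspace_lspan. Qed.

Lemma L0_subspace : subspace (L0 F T).
Proof.
apply/subspaceP; split=> [L lL _|a A B LA LB L lL XL]; have [_ sL _] := lL.
  exact: subspace0.
by apply: subspaceD => //; [apply: subspaceZ => //; exact: LA|exact: LB].
Qed.

Lemma L1_subspace : subspace (L1 F T).
Proof.
apply/subspaceP; split.
  exists 0; first exact: subspace0 Hspace_subspace.
  by exists 0; [exact: subspace0 L0_subspace|rewrite addr0].
move=> a _ _ [h Hh [b Lb <-]] [h' Hh' [b' Lb' <-]].
exists (a *: h + h').
  exact: (subspaceD Hspace_subspace (subspaceZ a Hspace_subspace Hh)).
exists (a *: b + b'); last by rewrite scalerDr addrACA.
exact: (subspaceD L0_subspace (subspaceZ a L0_subspace Lb)).
Qed.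

Lemma L1_monomial i l : Rset T i l -> L1 F T (D l i).
Proof.
move=> Rl; exists 0; first exact: subspace0 Hspace_subspace.
by exists (D l i); [exact: L0_monomial|rewrite add0r].
Qed.

Lemma Hspace_euler k : @Hspace F n (D U_(k)%MM k).
Proof. by apply: sub_lspan; exists k. Qed.

Lemma L1_euler k : L1 F T (D U_(k)%MM k).
Proof.
exists (D U_(k)%MM k); first exact: Hspace_euler.
by exists 0; [exact: subspace0 L0_subspace|rewrite addr0].
Qed.

(** Monomial operators are weight vectors for the Euler operators. *)
Lemma bracket_euler k l s :
  bracket (D U_(k)%MM k) (D l s) = ((l k)%:R - (k == s)%:R) *: D l s.
Proof.
rewrite bracket_monomial_deriv mnm1E scalerBl; congr (_ - _).
  case: (eqVneq (l k) 0%N) => [->|lk]; first by rewrite !scale0r.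
  by rewrite addmC submK // lep1mP.
case: eqP => [->|]; last by rewrite !scale0r.
by rewrite submm addm0.
Qed.

(** Weight components of elements of I lie in I: at a position k where the
    weight of a term c differs from w0, the operator
    (ad (x_k d_k) - c_k) / (w0_k - c_k) preserves I, fixes v0, kills c and
    only rescales the other terms. *)
Lemma weight_component (I : set op) (q : seq (op * ('I_n.+1 -> F))) v0 (w0 : 'I_n.+1 -> F) :
  subspace I -> (forall k A, I A -> I (bracket (D U_(k)%MM k) A)) ->
  (forall k, bracket (D U_(k)%MM k) v0 = w0 k *: v0) ->
  (forall c k, c \in q -> bracket (D U_(k)%MM k) c.1 = c.2 k *: c.1) ->
  (forall c, c \in q -> exists k, c.2 k <> w0 k) ->
  I (v0 + \sum_(c <- q) c.1) -> I v0.
Proof.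
move=> sI adI ev0; elim: {q}(size q) {-2}q (erefl (size q)) => [[]//|d IH [//|c q] [szq]].
  by rewrite big_nil addr0.
move=> ev ne; rewrite big_cons => Iu.
have [k ck] := ne c (mem_head _ _).
have ck' : w0 k - c.2 k != 0 by rewrite subr_eq0 eq_sym; apply/eqP.
have lE := @monomial_deriv_linear F n.+1 U_(k)%MM k.
have := subspaceB sI (adI k _ Iu) (subspaceZ (c.2 k) sI Iu).
have add B1 B2 : bracket (D U_(k)%MM k) (B1 + B2) =
    bracket (D U_(k)%MM k) B1 + bracket (D U_(k)%MM k) B2.
  by have := bracketDr 1 B1 B2 lE; rewrite !scale1r.
rewrite !add ev0 (ev c k) ?mem_head // !scalerDr opprD addrACA -scalerBl.
rewrite opprD addrACA subrr add0r bracket_sumr // scaler_sumr -sumrB.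
move=> /(subspaceZ (w0 k - c.2 k)^-1 sI).
rewrite scalerDr scalerA mulVf // scale1r scaler_sumr.
pose f (c' : op * ('I_n.+1 -> F)) := (((w0 k - c.2 k)^-1 * (c'.2 k - c.2 k)) *: c'.1, c'.2).
rewrite (_ : \sum_(i <- q) _ = \sum_(c' <- map f q) c'.1); last first.
  rewrite big_map /= big_seq [RHS]big_seq; apply: eq_bigr => c' c'q.
  by rewrite (ev c' k) ?inE ?c'q ?orbT // -scalerBl scalerA.
apply: IH; first by rewrite size_map.
  move=> c' k' /mapP[e eq ->] /=; rewrite bracketZr; last exact: monomial_deriv_linear.
  by rewrite ev ?inE ?eq ?orbT // !scalerA mulrC.
by move=> c' /mapP[e eq ->] /=; apply: ne; rewrite inE eq orbT.
Qed.

(** * From admissible pairs to abelian ideals *)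

Implicit Types (E : 'I_n.+1 -> set 'X_{1..n.+1}) (S : set 'I_n.+1)
  (K : 'I_n.+1 -> set 'X_{1..n.+1}).

(** Candidate for the set S of a pair whose ideal is spanned by the
    x^l d_s with l in E_s. *)
Definition bottom_nodes E : set 'I_n.+1 :=
  [set s | E s !=set0 /\ forall p, p \in clan T s -> E p !=set0 -> p = s].

(** Candidate for K_s: the elements of E_p for a proper ancestor p of s are
    already accounted for by K_p or further up. *)
Definition new_maximal E s : set 'X_{1..n.+1} :=
  [set l | [/\ E s l, forall h, E s h -> prec T s l h -> h = l &
    forall p, p \in clan T s -> E p l -> p = s]].

(** The exponents l for which x^l d_s is one of the spanning vectors of
    I[S, K]. *)
Definition pair_exponents S K s : set 'X_{1..n.+1} :=
  [set l | exists r j, [/\ Wset T S r, r \in clan T s, K r j, Rset T r l & prec T r l j]].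

Lemma WsetP S s : Wset T S s <-> exists2 i, S i & i \in clan T s.
Proof.
split=> [[Ss|[i Si is_]]|[i Si /clan_descendants[->|is_]]].
- by exists s => //; exact: clan_self.
- by exists i => //; apply/clan_descendants; right.
- by left.
- by right; exists i.
Qed.

Lemma I_pair_span S K : I_pair F T S K = lspan (monomial_ops (pair_exponents S K)).
Proof.
apply/seteqP; split.
  apply: (lspan_le (subspace_lspan _)) => A [r Wr [j Kj]].
  apply: (lspan_le (subspace_lspan _)) => _ [s [l [rs Rl lj ->]]].
  apply: sub_lspan; exists s, l; split=> //; exists r, j; split=> //.
  exact/clan_descendants.
apply: (lspan_le (subspace_lspan _)) => _ [s [l [[r [j [Wr rs Kj Rl lj]]] ->]]].
apply: sub_lspan; exists r => //; exists j => //; apply: sub_lspan.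
by exists s, l; split=> //; exact/clan_descendants.
Qed.

Section Admissible.
Variables (S : set 'I_n.+1) (K : 'I_n.+1 -> set 'X_{1..n.+1}).
Hypothesis adm : admissible_pair T S K.
Let E := pair_exponents S K.

Lemma admissible_clan_Rset i r l : S i -> i \in clan T r -> K r l -> Rset T i l.
Proof.
have [_ Ki Ke _ _] := adm => Si /clan_descendants[->|ir] Kl.
  by have [[KR _] _] := Ki i Si; exact: KR.
by have [KR _] := Ke i r Si ir; exact: KR.
Qed.

(** Although the sets I[r, j] are cut out of R_r, their exponents only involve
    proper ancestors of the element of S above r, because j does. *)
Lemma pair_exponents_Rset s l : E s l -> exists i, [/\ S i, i \in clan T s & Rset T i l].
Proof.
move=> [r [j [/WsetP[i Si ir] rs Kj Rl lj]]]; exists i; split=> //.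
  exact: clan_trans ir.
have [sl _] := Rl; have Rj := admissible_clan_Rset Si ir Kj.
by have [] := prec_restrict ir sl Rj lj.
Qed.

Lemma pair_exponents_sub s l : E s l -> Rset T s l.
Proof. by move=> /pair_exponents_Rset[i [_ iS Rl]]; exact: Rset_clan Rl. Qed.

Lemma pair_exponents_clan p s l : p \in clan T s -> E p l -> E s l.
Proof.
by move=> ps [r [j [Wr rp Kj Rl lj]]]; exists r, j; split=> //; exact: clan_trans rp.
Qed.

Lemma pair_exponents_step s l k j : E s l -> l k != 0%N -> Rset T k j ->
  E s (j + (l - U_(k)))%MM.
Proof.
move=> [r [j' [Wr rs Kj' Rl lj']]] lk Rj; exists r, j'; split=> //.
  exact: Rset_step.
have [sl _] := Rl; exact: prec_trans (prec_step sl lk Rj) lj'.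
Qed.

Lemma independent_clan i i' : S i -> S i' -> i \in clan T i' -> i = i'.
Proof.
have [[_ ind _] _ _ _ _] := adm => Si Si' /clan_descendants[->//|d].
by case: (ind i i' Si Si').
Qed.

(** Commutativity of I[S, K]: if x^l involved x_s', the element of S above s'
    would be a proper ancestor of the one above s. *)
Lemma pair_exponents_ancestor s s' l l' : E s l -> E s' l' -> l s' = 0%N.
Proof.
move=> /pair_exponents_Rset[i [Si _ [sl _]]] /pair_exponents_Rset[i' [Si' i's' _]].
apply/eqP; apply/negP => /negP /sl[s'i /eqP ne]; apply: ne.
have e := independent_clan Si' Si (clan_trans s'i i's').
by rewrite -e in s'i *; exact: (clan_anti s'i).
Qed.

Lemma pair_exponents_self r j : K r j -> E r j.
Proof.
move=> Kj; have Wr : Wset T S r.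
  by apply: contrapT => nW; have [_ _ _ _ K0] := adm; move: Kj; rewrite K0.
exists r, j; split=> //; first exact: clan_self.
move/WsetP: Wr => [i Si ir]; exact: Rset_clan ir (admissible_clan_Rset Si ir Kj).
Qed.

Lemma pair_exponents_nonempty s : E s !=set0 <-> Wset T S s.
Proof.
split=> [[l /pair_exponents_Rset[i [Si iS _]]]|/WsetP[i Si iS]].
  by apply/WsetP; exists i.
have [_ Ki _ _ _] := adm; have [_ [j Kj]] := Ki i Si.
by exists j; apply: pair_exponents_clan iS _; exact: pair_exponents_self.
Qed.

Lemma admissible_bottom_nodes : bottom_nodes E = S.
Proof.
apply/seteqP; split=> s.
  move=> [/pair_exponents_nonempty/WsetP[i Si iS] mini].
  rewrite -(mini i) //; apply/pair_exponents_nonempty.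
  by left.
move=> Ss; split; first by apply/pair_exponents_nonempty; left.
move=> p ps /pair_exponents_nonempty/WsetP[i Si ip].
have e := independent_clan Si Ss (clan_trans ps ip); rewrite e in ip.
exact: (clan_anti ps).
Qed.

(** The conditions of an admissible pair say that no element of K_s lies below
    another one of K_s or below one of K_r for a proper ancestor r of s, so
    that exactly the elements of K_s are new and maximal at s. *)
Lemma new_maximal_pair : new_maximal E = K.
Proof.
have [_ Ki Ke Kne K0] := adm.
apply/funext => s; apply/seteqP; split=> l.
  move=> [[r [j [Wr rs Kj Rl lj]]] max new].
  have er : r = s.
    apply: new => //; exists r, j; split=> //; exact: clan_self.
  by rewrite er in Kj lj; rewrite -(max j) //; exact: pair_exponents_self.
move=> Kl; have Wr : Wset T S s.
  by apply: contrapT => nW; move: Kl; rewrite K0.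
have [i Si iS] := (WsetP S s).1 Wr.
have Ril := admissible_clan_Rset Si iS Kl; have [sil _] := Ril.
have sl := proper_support_clan iS sil.
have up r j h : r \in clan T s -> Wset T S r -> K r j -> Rset T r h -> prec T r h j ->
    prec T s h j /\ (prec T s l h -> r = s).
  move=> rs Wr' Kj [sh _] hj; have [sj _] := pair_exponents_sub (pair_exponents_self Kj).
  have hj' := prec_clan rs sh sj hj; split=> // lh.
  apply: contrapT => /eqP ne; apply: (Kne r s Wr' _ j l Kj Kl); last exact: prec_trans hj'.
  exact/descendantsP.
split; first exact: pair_exponents_self.
  move=> h [r [j [Wr' rs Kj Rh hj]]] lh; have [hj' e] := up r j h rs Wr' Kj Rh hj.
  have {}e := e lh; rewrite {}e in Kj Rh hj.
  have Rij := admissible_clan_Rset Si iS Kj; have [sij _] := Rij.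
  have lj := prec_trans lh hj'.
  have [_ lji] := prec_restrict iS sl Rij lj.
  have ejl : j = l.
    move: iS => /clan_descendants[es|ds].
      by have [[_ ind] _] := Ki i Si; apply: ind; rewrite -?es.
    by have [_ ind] := Ke i s Si ds; exact: ind lji.
  rewrite ejl in hj'; have [sh _] := Rh.
  exact: (prec_anti sh sl).
move=> p ps [r [j [Wr' rp Kj Rl lj]]].
have rs := clan_trans ps rp.
have [_ e] := up r j l rs Wr' Kj Rl lj; apply: (clan_anti ps).
by rewrite -(e (prec_refl l)).
Qed.

(** Brackets with ancestors are trades, under which the exponents are stable
    ([pair_exponents_step]); in brackets with x^j d_k at a descendant k,
    [Upsilon_Rset] leaves only j = e_s, which moves x^l d_s to x^l d_k. *)
Lemma admissible_ideal : nonzero_abelian_ideal (L1 F T) (I_pair F T S K).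
Proof.
rewrite I_pair_span -/E; have sZ := @subspace_lspan F op (monomial_ops E).
have [[[i Si] _ SU] Ki _ _ _] := adm.
have lin := @monomial_ops_linear F n.+1.
have Z1 s k l j : E s l -> (l k != 0%N -> Rset T k j) ->
    lspan (monomial_ops E) ((l k)%:R *: D (j + (l - U_(k)))%MM s).
  move=> El Rj; case: (eqVneq (l k) 0%N) => [->|lk].
    by rewrite scale0r; exact: subspace0.
  apply: (subspaceZ _ sZ); apply: sub_lspan; exists s, (j + (l - U_(k)))%MM; split=> //.
  exact: pair_exponents_step (Rj lk).
have Z2 s k l j : E s l -> Rset T k j ->
    lspan (monomial_ops E) ((j s)%:R *: D (l + (j - U_(s)))%MM k).
  move=> El Rj; case: (eqVneq (j s) 0%N) => [->|js].
    by rewrite scale0r; exact: subspace0.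
  have [i' [Si' i's _]] := pair_exponents_Rset El.
  have [sj _] := Rj; have [sk snk] := sj s js.
  have ds : descendants T s k by exact/descendantsP.
  have Us : Upsilon T s.
    move: i's => /clan_descendants[->|d]; first exact: SU.
    by apply: Upsilon_descendants d; exact: SU.
  have ej := Upsilon_Rset Us Rj ds js.
  apply: (subspaceZ _ sZ); apply: sub_lspan; exists k, l; split.
    exact: pair_exponents_clan El.
  by rewrite ej submm addm0.
split; last first.
- have [_ [j Kj]] := Ki i Si; exists (D j i); last exact: monomial_deriv_neq0.
  by apply: sub_lspan; exists i, j; split=> //; exact: pair_exponents_self.
- apply: (bracket_lspan (lin _) (lin _) (@subspace_set1 F op)).
  move=> _ _ [k [j [Ej ->]]] [s [l [El ->]]]; rewrite bracket_monomial_deriv.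
  by rewrite (pair_exponents_ancestor El Ej) (pair_exponents_ancestor Ej El) !scale0r subr0.
split=> //.
  apply: (lspan_le L1_subspace) => _ [s [l [El ->]]].
  by apply: L1_monomial; exact: pair_exponents_sub.
move=> _ B [h Hh [b Lb <-]] EB.
have -> : bracket (h + b) B = bracket h B + bracket b B.
  have lB := lspan_linear (lin E) EB.
  rewrite bracketN [bracket h B]bracketN [bracket b B]bracketN -opprD; congr (- _).
  by have := bracketDr 1 h b lB; rewrite !scale1r.
apply: (subspaceD sZ).
  apply: (@bracket_lspan _ _ _ _ _ _ (lin E) sZ) Hh EB => [_ [k _ <-]|].
    exact: monomial_deriv_linear.
  move=> _ _ [k _ <-] [s [l [El ->]]].
  rewrite bracket_euler; apply: (subspaceZ _ sZ); apply: sub_lspan.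
  by exists s, l.
apply: (bracket_lspan (lin _) (lin E) sZ _ (L0_span Lb) EB).
move=> _ _ [k [j [Rj ->]]] [s [l [El ->]]]; rewrite bracket_monomial_deriv.
by apply: (subspaceB sZ); [exact: Z1|exact: Z2].
Qed.

End Admissible.
(** * From abelian ideals to admissible pairs *)

Lemma Hspace_sum h : Hspace h -> exists a : 'I_n.+1 -> F,
  h = \sum_k a k *: D U_(k)%MM k.
Proof.
move: h; apply: lspan_le => [|_ [k _ <-]]; last first.
  exists (fun i => (i == k)%:R); rewrite (bigD1 k) //= eqxx scale1r big1 ?addr0 //.
  by move=> i /negbTE ->; rewrite scale0r.
apply/subspaceP; split.
  by exists (fun=> 0); rewrite big1 // => k _; rewrite scale0r.
move=> c _ _ [a ->] [b ->]; exists (fun k => c * a k + b k).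
by rewrite scaler_sumr -big_split /=; apply: eq_bigr => k _; rewrite scalerDl scalerA.
Qed.

Section AbelianIdeal.
Variable I : set op.
Hypothesis idealI : lie_ideal (L1 F T) I.
Hypothesis abI : abelian I.

Let sI : subspace I.
Proof. by have [] := idealI. Qed.

Let adI A B : L1 F T A -> I B -> I (bracket A B).
Proof. by have [_ _] := idealI; exact. Qed.

Definition ideal_exponents s : set 'X_{1..n.+1} := [set l | Rset T s l /\ I (D l s)].

(** If h = sum_k a_k x_k d_k is in I, then so is [d_k, h] = a_k d_k, which
    commutes with h only if a_k = 0. *)
Lemma ideal_Hspace h : Hspace h -> I h -> h = 0.
Proof.
move=> /Hspace_sum[a ->] Ih; rewrite big1 // => k _.
set u := \sum_i _ in Ih.
have lin l s := @monomial_deriv_linear F n.+1 l s.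
have e : bracket (D 0%MM k) u = a k *: D 0%MM k.
  rewrite /u bracket_sumr // (bigD1 k) //= big1 ?addr0 => [|i ik]; rewrite bracketZr //.
    rewrite bracketN bracket_euler eqxx mnm0E sub0r -scalerN.
    by rewrite scaleN1r opprK.
  by rewrite bracketN bracket_euler mnm0E (negbTE ik) subrr scale0r oppr0 scaler0.
have [->|ak] := eqVneq (a k) 0; first by rewrite scale0r.
have ID : I (D 0%MM k).
  have := adI (L1_monomial (Rset0 T k)) Ih; rewrite e => /(subspaceZ (a k)^-1 sI).
  by rewrite scalerA mulVf // scale1r.
have /eqP := abI ID Ih; rewrite e scaler_eq0 (negbTE ak) /= => /eqP.
by move/monomial_deriv_neq0.
Qed.

(** Equal s leaves two different exponents; otherwise k = s0 works, where the
    weight of x^l0 d_s0 is -1 and that of x^l d_s is not negative. *)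
Lemma weight_separate s l s0 l0 : Rset T s l -> Rset T s0 l0 -> (l, s) != (l0, s0) ->
  exists k, (l k)%:R - (k == s)%:R <> (l0 k)%:R - (k == s0)%:R :> F.
Proof.
move=> [sl _] [sl0 _] ne; have [es|nes] := eqVneq s s0.
  apply: contrapT => nex; case/eqP: ne; rewrite es; congr pair; apply/mnmP => k.
  apply/eqP; rewrite -(eqr_nat F); apply/negPn/negP => nk; apply: nex; exists k.
  by rewrite es => /addIr e; rewrite e eqxx in nk.
exists s0; rewrite eqxx (proper_support_above sl0 (clan_self T s0)) eq_sym (negbTE nes).
rewrite subr0 sub0r => /eqP; rewrite -subr_eq0 opprK -natrD addn1.
by rewrite pnatr_eq0.
Qed.

Lemma weight_nonzero s l : Rset T s l -> (l s)%:R - (s == s)%:R <> 0 :> F.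
Proof.
move=> [sl _]; rewrite eqxx (proper_support_above sl (clan_self T s)) sub0r.
by move/eqP; rewrite oppr_eq0 oner_eq0.
Qed.

(** The sum over H and the monomials that represents an element of I is taken
    apart by weights: first H is split off, then one monomial after the other
    with all the terms that it accounts for. *)
Lemma ideal_sub_span : I `<=` lspan (monomial_ops ideal_exponents).
Proof.
move=> B IB; have [IL1 _ _] := idealI.
have [h Hh [b /L0_span/monomial_spanP[q qR ->] eB]] := IL1 _ IB.
have adE k A : I A -> I (bracket (D U_(k)%MM k) A) by apply: adI; exact: L1_euler.
have eig (q' : seq (F * ('X_{1..n.+1} * 'I_n.+1))) v0 w0 :
    (forall k, bracket (D U_(k)%MM k) v0 = w0 k *: v0) ->
    (forall c, c \in q' -> exists k, (c.2.1 k)%:R - (k == c.2.2)%:R <> w0 k) ->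
    I (v0 + \sum_(c <- q') c.1 *: D c.2.1 c.2.2) -> I v0.
  move=> ev0 sep.
  pose f (c : F * ('X_{1..n.+1} * 'I_n.+1)) : op * ('I_n.+1 -> F) :=
    (c.1 *: D c.2.1 c.2.2, fun k => (c.2.1 k)%:R - (k == c.2.2)%:R).
  have -> : \sum_(c <- q') c.1 *: D c.2.1 c.2.2 = \sum_(c <- map f q') c.1.
    by rewrite big_map.
  apply: weight_component sI adE ev0 _ _.
    move=> _ k /mapP[c cq ->] /=; rewrite bracketZr; last exact: monomial_deriv_linear.
    by rewrite bracket_euler !scalerA mulrC.
  by move=> _ /mapP[c cq ->] /=; exact: sep.
have h0 : h = 0.
  apply: (ideal_Hspace Hh); apply: (eig q h (fun=> 0)); last by rewrite eB.
    move=> k; rewrite scale0r; have [a ->] := Hspace_sum Hh.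
    rewrite bracket_sumr; last exact: monomial_deriv_linear.
    rewrite big1 // => i _; rewrite bracketZr; last exact: monomial_deriv_linear.
    by rewrite bracket_euler mnm1E eq_sym subrr scale0r scaler0.
  by move=> c /qR Rc; exists c.2.2; exact: weight_nonzero.
rewrite h0 add0r in eB; rewrite -eB in IB *.
elim/ltn_ind: {q eB}(size q) {-2}q (erefl (size q)) qR IB => d IH [|c0 q'] szq qR IB.
  by rewrite big_nil; apply: subspace0; exact: subspace_lspan.
set q := c0 :: q' in szq qR IB *; set m0 := c0.2.
have R0 : Rset T m0.2 m0.1 by apply: qR; exact: mem_head.
pose P (c : F * ('X_{1..n.+1} * 'I_n.+1)) := c.2 == m0.
have split_sum : \sum_(c <- q) c.1 *: D c.2.1 c.2.2 =
    (\sum_(c <- q | P c) c.1) *: D m0.1 m0.2 +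
    \sum_(c <- filter (predC P) q) c.1 *: D c.2.1 c.2.2.
  rewrite (bigID P) big_filter scaler_suml; congr (_ + _).
  by apply: eq_bigr => c /eqP ->.
have I0 : I ((\sum_(c <- q | P c) c.1) *: D m0.1 m0.2).
  rewrite split_sum in IB.
  apply: (eig _ _ (fun k => (m0.1 k)%:R - (k == m0.2)%:R) _ _ IB) => [k|c].
    rewrite bracketZr; last exact: monomial_deriv_linear.
    by rewrite bracket_euler !scalerA mulrC.
  rewrite mem_filter => /andP[nP cq]; apply: weight_separate => //.
  exact: qR.
rewrite split_sum; apply: (subspaceD (subspace_lspan _)).
  have [->|a0] := eqVneq (\sum_(c <- q | P c) c.1) 0.
    by rewrite scale0r; apply: subspace0; exact: subspace_lspan.
  apply: (subspaceZ _ (subspace_lspan _)); apply: sub_lspan.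
  exists m0.2, m0.1; split=> //; split=> //.
  move: I0 => /(subspaceZ (\sum_(c <- q | P c) c.1)^-1 sI).
  by rewrite scalerA mulVf // scale1r.
apply: (IH (size (filter (predC P) q))) => //.
- by rewrite -szq size_filter /q /= /P eqxx add0n ltnS count_size.
- by move=> c; rewrite mem_filter => /andP[_]; exact: qR.
- by move: IB; rewrite split_sum => /(subspaceB sI)/(_ I0); rewrite addrAC subrr add0r.
Qed.

Lemma ideal_exponents_step s l k j : ideal_exponents s l -> l k != 0%N -> Rset T k j ->
  ideal_exponents s (j + (l - U_(k)))%MM.
Proof.
move=> [Rl Il] lk Rj; split; first exact: Rset_step.
have [sl _] := Rl; have [ks _] := sl k lk; have [sj _] := Rj.
by apply: bracket_ancestor => //; apply: adI => //; exact: L1_monomial.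
Qed.

Lemma ideal_exponents_prec s l h : ideal_exponents s l -> proper_support T s h ->
  prec T s h l -> ideal_exponents s h.
Proof.
move=> El sh; have [[sl _] _] := El.
apply: (descent _ sl sh El) => l' k j; exact: ideal_exponents_step.
Qed.

Lemma ideal_descendant s l k j : ideal_exponents s l -> descendants T s k ->
  Rset T k j -> j s != 0%N -> I (D (l + (j - U_(s)))%MM k).
Proof.
move=> [[sl _] Il] /descendantsP[sk _] Rj js.
apply: bracket_ancestor => //; rewrite bracketN; apply: subspaceN => //.
by apply: adI => //; exact: L1_monomial.
Qed.

Lemma ideal_exponents_clan s k l : s \in clan T k -> ideal_exponents s l ->
  ideal_exponents k l.
Proof.
move=> /clan_descendants[-> //|sk] El; have [Rl _] := El.
have /descendantsP[skc skn] := sk.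
split; first exact: Rset_clan Rl.
have Rs := Rset_mnm1 skc skn.
have := ideal_descendant El sk Rs; rewrite mnm1E eqxx => /(_ isT).
by rewrite submm addm0.
Qed.

(** Otherwise [x^l d_s, x^j d_k] would be a nonzero multiple of a monomial
    operator. *)
Lemma ideal_exponents_zero s l k j : ideal_exponents s l -> s \in clan T k ->
  I (D j k) -> j s = 0%N.
Proof.
move=> [[sl _] Il] sk Ij; apply/eqP; apply/negP => /negP js.
have := bracket_ancestor (@subspace_set1 F op) sl sk js (abI Il Ij).
by move/monomial_deriv_neq0.
Qed.

(** If an edge (p, k) below s had multiplicity at least 2, then 2 e_p would be
    in R_k; with x^l d_p, the ideal would contain x^(l + e_p) d_k, and these
    two do not commute. *)
Lemma ideal_Upsilon s : ideal_exponents s !=set0 -> Upsilon T s.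
Proof.
move=> [l El] k sk; have /descendantsP[skc skn] := sk.
have dk0 := leq_ltn_trans (leq0n _) (depth_lt skc skn).
have [p [pk pc pn dp prodp]] := parentP dk0.
have Ep := ideal_exponents_clan (clan_parent pk skc skn) El.
exists p; split=> //; first exact: (edge_lt pk).
apply/eqP; rewrite eqn_leq (edge_mult_gt0 pk) andbT leqNgt; apply/negP => d1.
have R2 : Rset T k (U_(p) + U_(p))%MM.
  have [s1 _] := Rset_mnm1 pc pn.
  split=> [m|]; first by rewrite mnmDE => m0; apply: s1; move: m0; lia.
  by rewrite weightD weight_mnm1 // leq0n prodp // addnn -muln2 leq_mul2l d1 orbT.
have dpk : descendants T p k by apply/descendantsP.
have := ideal_descendant Ep dpk R2; rewrite mnmDE mnm1E eqxx addmK => /(_ isT).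
move/(ideal_exponents_zero Ep pc); rewrite mnmDE mnm1E eqxx; lia.
Qed.

Lemma exists_bottom s : ideal_exponents s !=set0 ->
  exists2 i, bottom_nodes ideal_exponents i & i \in clan T s.
Proof.
elim/ltn_ind: {s}(s : nat) {-2}s (erefl (s : nat)) => d IH s sd ne.
have [b|nb] := pselect (bottom_nodes ideal_exponents s).
  by exists s => //; exact: clan_self.
have [p [ps nep nps]] : exists p, [/\ p \in clan T s, ideal_exponents p !=set0 & p != s].
  apply: contrapT => nex; apply: nb; split=> // p ps nep.
  by apply/eqP; apply/negP => /negP nps; apply: nex; exists p.
have /descendantsP[lt _] := conj ps nps.
have [|i bi ip] := IH p _ p erefl nep; first by rewrite -sd.
by exists i => //; exact: clan_trans ip.
Qed.

Lemma bottom_Wset s : Wset T (bottom_nodes ideal_exponents) s <-> ideal_exponents s !=set0.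
Proof.
split=> [/WsetP[i [[l El] _] iS]|/exists_bottom[i bi iS]]; last by apply/WsetP; exists i.
by exists l; exact: ideal_exponents_clan El.
Qed.

(** By [ideal_exponents_zero], x^l does not involve nodes with nonempty
    exponent set, such as i and the nodes between i and s; by [Upsilon_prod]
    the bounds on R_s and R_i agree. *)
Lemma bottom_Rset i s l : bottom_nodes ideal_exponents i -> i \in clan T s ->
  ideal_exponents s l -> Rset T i l.
Proof.
move=> [nei mini] iS El; have [Rl Il] := El; have [sl wl] := Rl.
have sil : proper_support T i l.
  move=> k lk; have [ks kns] := sl k lk.
  have nek : ideal_exponents k = set0.
    apply/seteqP; split=> // l' El'.
    by rewrite (ideal_exponents_zero El' ks Il) eqxx in lk.
  have nik : i \notin clan T k.
    apply/negP => ik; have [l' El'] := nei.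
    have := ideal_exponents_clan ik El'; by rewrite nek.
  have [ki|ik] := clan_total ks iS; last by rewrite ik in nik.
  by split=> //; apply: contraNneq nik => ->; exact: clan_self.
split=> //; rewrite -(weight_clan _ iS sil) (leq_trans wl) //.
by rewrite (Upsilon_prod _ iS) //; exact: ideal_Upsilon.
Qed.

Let K := new_maximal ideal_exponents.
Let S := bottom_nodes ideal_exponents.

Lemma ideal_maximal_above s l : ideal_exponents s l ->
  exists2 h, ideal_exponents s h /\ prec T s l h &
    forall h', ideal_exponents s h' -> prec T s h h' -> h' = h.
Proof. by apply: maximal_above => h []. Qed.

Lemma ideal_admissible : (exists2 A, I A & A <> 0) -> admissible_pair T S K.
Proof.
move=> [A IA A0]; split.
- split.
  + have [[s [l El]]|nE] := pselect (exists s, ideal_exponents s !=set0).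
      by have [|i bi _] := @exists_bottom s; [exists l|exists i].
    case: A0; move: A IA => A /ideal_sub_span; move: A.
    apply: (lspan_le (@subspace_set1 F op)).
    by move=> B [s [l [El _]]]; case: nE; exists s, l.
  + move=> i j [nei _] [_ minj] /descendantsP[ij /eqP]; apply.
    exact: minj.
  + by move=> i [nei _]; exact: ideal_Upsilon.
- move=> i bi; split.
    split; first by move=> l [[Rl _] _ _].
    by move=> j l [_ maxj _] [El _ _] jl; exact: maxj.
  have [[l El] mini] := bi; have [h [Eh _] max] := ideal_maximal_above El.
  by exists h; split=> // p pi Ep; apply: mini => //; exists h.
- move=> i s bi /descendantsP[iS _]; split.
    by move=> l [El _ _]; exact: bottom_Rset El.
  move=> j l [Ej maxj _] [El _ _] jl; apply: maxj => //.
  have [sj _] := bottom_Rset bi iS Ej; have [sl _] := bottom_Rset bi iS El.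
  exact: prec_clan iS sj sl jl.
- move=> r s Wr /descendantsP[rs /eqP ne] j l [Ej _ _] [El maxl newl] lj.
  apply: ne; apply: newl => //.
  by rewrite -(maxl j) //; exact: ideal_exponents_clan Ej.
- move=> r nW; apply/seteqP; split=> // l [El _ _].
  by apply: nW; apply/bottom_Wset; exists l.
Qed.

(** An exponent l of E_s lies below a maximal element h of E_r, where r is the
    topmost ancestor of s with l in E_r; then h is new at r, since h in E_p
    would put l into E_p. *)
Lemma ideal_pair_exponents : pair_exponents S K = ideal_exponents.
Proof.
apply/funext => s; apply/seteqP; split=> l.
  move=> [r [j [Wr rs [Ej _ _] [sl _] lj]]].
  by apply: ideal_exponents_clan rs _; exact: ideal_exponents_prec lj.
elim/ltn_ind: {s}(s : nat) {-2}s (erefl (s : nat)) => d IH s sd El.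
have [[p [ps Ep nps]]|nex] :=
  pselect (exists p, [/\ p \in clan T s, ideal_exponents p l & p != s]).
  have /descendantsP[lt _] := conj ps nps.
  by apply: pair_exponents_clan ps _; apply: (IH p) => //; rewrite -sd.
have [Rl Il] := El; have [sl _] := Rl.
have [h [Eh lh] max] := ideal_maximal_above El.
exists s, h; split=> //; [by apply/bottom_Wset; exists l|exact: clan_self|split=> //].
move=> p ps Eph; apply/eqP; apply/negP => /negP nps; apply: nex; exists p; split=> //.
have [Rh _] := Eph; have [[spl _] lph] := prec_restrict ps sl Rh lh.
exact: ideal_exponents_prec lph.
Qed.

Lemma ideal_pair : I = I_pair F T S K.
Proof.
rewrite I_pair_span ideal_pair_exponents; apply/seteqP; split; first exact: ideal_sub_span.
by apply: lspan_le => // _ [s [l [[_ Il] ->]]].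
Qed.

End AbelianIdeal.

Theorem nonzero_abelian_ideal_pair (I : set op) : nonzero_abelian_ideal (L1 F T) I ->
  exists S K, admissible_pair T S K /\ I = I_pair F T S K.
Proof.
move=> [idI abI nz]; exists (bottom_nodes (ideal_exponents I)).
exists (new_maximal (ideal_exponents I)).
by split; [exact: ideal_admissible|exact: ideal_pair].
Qed.

(** I[S, K] determines its monomial operators, hence the family of exponents,
    from which S and K are read off. *)
Theorem I_pair_inj S K S' K' : admissible_pair T S K -> admissible_pair T S' K' ->
  I_pair F T S K = I_pair F T S' K' -> (S, K) = (S', K').
Proof.
move=> adm adm' eI; have eE : pair_exponents S K = pair_exponents S' K'.
  apply/funext => s; apply/seteqP; split=> l El;
    apply: (@lspan_monomial_deriv F); rewrite -?I_pair_span.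
    by rewrite -eI I_pair_span; apply: sub_lspan; exists s, l.
  by rewrite eI I_pair_span; apply: sub_lspan; exists s, l.
have eS := admissible_bottom_nodes adm; have eK := new_maximal_pair adm.
rewrite eE (admissible_bottom_nodes adm') in eS; rewrite eE (new_maximal_pair adm') in eK.
by rewrite eS eK.
Qed.

End TreeLieAlgebra.

Theorem theorem2p8 (R : realType) (n : nat) (T : tree_diagram n) :
  (forall I : set (mpoly_op R[i] n.+1),
     nonzero_abelian_ideal (L1 R[i] T) I ->
     exists S K, admissible_pair T S K /\ I = I_pair R[i] T S K) /\
  set_bij
    [set p : set 'I_n.+1 * ('I_n.+1 -> set 'X_{1..n.+1}) |
       admissible_pair T p.1 p.2]
    [set I : set (mpoly_op R[i] n.+1) | nonzero_abelian_ideal (L1 R[i] T) I]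
    (fun p => I_pair R[i] T p.1 p.2).
Proof.
split; first exact: nonzero_abelian_ideal_pair.
split.
- by move=> [S K] /= adm; exact: admissible_ideal.
- by move=> [S K] [S' K'] /set_mem adm /set_mem adm'; exact: I_pair_inj.
- by move=> I /nonzero_abelian_ideal_pair[S [K [adm ->]]]; exists (S, K).
Qed.
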